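(* Let $K=\{k_1,k_2\}$ and $I=J=\{\ell,r\}$, and consider the alternating-move two-player zero-sum repeated game with incomplete information on one side whose payoff function is $$f(k,i_0,j_1,i_2,j_3,\ldots)=\begin{cases}-1, & \text{if } k=k_1 \text{ and } j_{2t+1}=\ell \text{ for infinitely many } t,\\ 2, & \text{if } k=k_2 \text{ and } j_{2t+1}=\ell \text{ for infinitely many } t,\\ -2, & \text{if } k=k_1,\ j_{2t+1}=\ell \text{ for only finitely many } t, \text{ and } i_{2t}=\ell \text{ for infinitely many } t,\\ 1, & \text{if } k=k_2,\ j_{2t+1}=\ell \text{ for only finitely many } t, \text{ and } i_{2t}=\ell \text{ for infinitely many } t,\\ 0, & \text{otherwise.}\end{cases}$$ Then $f$ is shift invariant (in particular, tail measurable), and the game $\Gamma(\tfrac12)$, in which the prior assigns probability $\tfrac12$ to each of $k_1$ and $k_2$, does not admit a value.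
   Context: Notation: $\mathbb{N}=\{0,1,2,\ldots\}$; for a finite set $X$, $\Delta(X)$ is the set of probability distributions on $X$. The alternating-move game: Nature selects a state $k^*\in K$ according to the prior and reveals $k^*$ to Player I but not to Player II. Player I selects actions only in even stages ($i_{2t}\in I$ at stage $2t$) and Player II selects actions only in odd stages ($j_{2t+1}\in J$ at stage $2t+1$). Each player observes all past actions before acting. A play is a sequence $(k,i_0,j_1,i_2,j_3,\ldots)$. The payoff, which Player I maximizes and Player II minimizes, is $f(k^*,i_0,j_1,i_2,j_3,\ldots)$. Strategies (behavior strategies): a strategy $\sigma$ of Player I assigns to each state $k\in K$ and each finite sequence of past actions $(i_0,j_1,\ldots,i_{2t-2},j_{2t-1})$, $t\in\mathbb{N}$, an element of $\Delta(I)$; a strategy $\tau$ of Player II assigns to each finite sequence of past actions $(i_0,j_1,\ldots,j_{2t-1},i_{2t})$, $t\in\mathbb{N}$, an element of $\Delta(J)$ (not depending on the state). Let $\mathcal{S}$ and $\mathcal{T}$ be the sets of strategies of Players I and II. A prior $p$ and a pair $(\sigma,\tau)$ induce a probability distribution on plays, with expectation $\mathbf{E}_{p,\sigma,\tau}$. Value: the maxmin value is $\underline{v}(p)=\sup_{\sigma\in\mathcal{S}}\inf_{\tau\in\mathcal{T}}\mathbf{E}_{p,\sigma,\tau}[f]$ and the minmax value is $\overline{v}(p)=\inf_{\tau\in\mathcal{T}}\sup_{\sigma\in\mathcal{S}}\mathbf{E}_{p,\sigma,\tau}[f]$. The game with prior $p$ admits a value if $\underline{v}(p)=\overline{v}(p)$.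 Shift invariance: $f$ is shift invariant if $f(k,i_0,j_1,i_2,j_3,\ldots)=f(k,i_2,j_3,i_4,j_5,\ldots)$ for every play $(k,i_0,j_1,i_2,j_3,\ldots)$. Tail measurability: $f$ is tail measurable if, for every $k\in K$, $f(k,\cdot)$ takes the same value on any two sequences of actions $(i_0,j_1,i_2,j_3,\ldots)$ that differ in only finitely many coordinates. *)

(* Defs.v *)
From HB Require Import structures.
From mathcomp Require Import all_boot all_order all_algebra.
From mathcomp Require Import all_classical all_reals all_analysis.

Set Implicit Arguments.
Unset Strict Implicit.
Unset Printing Implicit Defensive.

Import Order.TTheory GRing.Theory Num.Theory.
Import numFieldNormedType.Exports.

Local Open Scope classical_set_scope.
Local Open Scope ring_scope.

(* Nonempty finite sets; the distinguished point only serves to make the type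
   of plays a measurable type, which the library requires to be pointed. *)
#[short(type="pointedFinType")]
HB.structure Definition PointedFinite := {T of Finite T & Pointed T}.
HB.saturate bool.

Record fdist (R : realType) (X : finType) := FDist {
  fdist_fun :> X -> R;
  fdist_ge0 : forall x, 0 <= fdist_fun x;
  fdist_sum1 : \sum_x fdist_fun x = 1 }.

Section game.
Variables (R : realType) (K I J : pointedFinType).

(* The play (k, i_0, j_1, i_2, j_3, ...) is represented as (k, a) with
   a t = (i_{2t}, j_{2t+1}). *)
Definition play := (K * (nat -> I * J))%type.

Definition cylinder (k : K) (h : seq (I * J)) : set play :=
  [set w | w.1 = k /\ mkseq w.2 (size h) = h].

Definition cylinders : set (set play) :=
  [set A | exists k h, A = cylinder k h].

Definition plays := g_sigma_algebraType cylinders.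

(* Player I moves at stage 2t knowing k and (i_0, j_1, ..., j_{2t-1}). *)
Definition strategyI := K -> seq (I * J) -> fdist R I.

(* Player II moves at stage 2t+1 knowing (i_0, j_1, ..., j_{2t-1}) and i_{2t},
   but not k. *)
Definition strategyII := seq (I * J) -> I -> fdist R J.

Definition cylinder_weight (p : fdist R K) (sigma : strategyI)
    (tau : strategyII) (k : K) (h : seq (I * J)) : R :=
  p k * \prod_(t < size h)
    let a := nth point h t in
    let past := take t h in
    sigma k past a.1 * tau past a.1 a.2.

Definition induced_by (p : fdist R K) (sigma : strategyI) (tau : strategyII)
    (P : probability plays R) : Prop :=
  forall k h, P (cylinder k h) = (cylinder_weight p sigma tau k h)%:E.

(* Existence of the induced distribution: it is the image of the Lebesgue
   measure on [0, 1[ under the map that reads off a play from successive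
   subdivisions of [0, 1[ into subintervals of prescribed lengths. *)
Section subdivision.
Variables (X : finType) (d : fdist R X).

Let cum n := \sum_(y <- take n (enum X)) d y.

Local Definition cut (x : X) : R := cum (index x (enum X)).

Let cum_le m n : (m <= n)%N -> cum m <= cum n.
Proof.
move=> mn; rewrite /cum -(subnKC mn) takeD big_cat/= lerDl.
by apply: sumr_ge0 => y _; exact: fdist_ge0.
Qed.

Let cumS x : cum (index x (enum X)).+1 = cut x + d x.
Proof.
have xX : (index x (enum X) < size (enum X))%N by rewrite index_mem mem_enum.
by rewrite /cut /cum (take_nth x)// nth_index ?mem_enum// -cats1 big_cat big_seq1.
Qed.

Local Definition inpart (b : R * R) (x : X) : R * R :=
  (b.1 + b.2 * cut x, b.2 * d x).

Local Definition inbox (u : R) (b : R * R) := b.1 <= u < b.1 + b.2.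

Local Lemma inpart_ge0 b x : 0 <= b.2 -> 0 <= (inpart b x).2.
Proof. by move=> b0; rewrite mulr_ge0// fdist_ge0. Qed.

Local Lemma inpart_sub u b x : 0 <= b.2 -> inbox u (inpart b x) -> inbox u b.
Proof.
move=> b0; rewrite /inbox/= -addrA -mulrDr -cumS => /andP[h1 h2].
have c0 : 0 <= cut x by apply: sumr_ge0 => y _; exact: fdist_ge0.
apply/andP; split; first by rewrite (le_trans _ h1)// lerDl mulr_ge0.
rewrite (lt_le_trans h2)// lerD2l ler_piMr//.
rewrite -(fdist_sum1 d) -(@big_enum _ _ _ _ predT)/=.
rewrite (le_trans (cum_le (_ : _ <= size (enum X))%N))//.
  by rewrite index_mem mem_enum.
by rewrite /cum take_size.
Qed.

Local Lemma inpart_ex u b : 0 <= b.2 -> inbox u b -> exists x, inbox u (inpart b x).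
Proof.
move=> b0 /andP[b1u ub].
have ex : exists n, u < b.1 + b.2 * cum n.
  exists (size (enum X)); rewrite /cum take_size.
  by have := fdist_sum1 d; rewrite -(@big_enum _ _ _ _ predT)/= => ->; rewrite mulr1.
have [[|n] un nmin] := ex_minnP ex.
  by move: un; rewrite /cum take0 big_nil mulr0 addr0 ltNge b1u.
have nX : (n < size (enum X))%N.
  rewrite ltnNge; apply/negP => Xn.
  suff : (n.+1 <= n)%N by rewrite ltnn.
  apply: nmin; move: un; rewrite /cum !take_oversize//.
  exact: leq_trans Xn _.
have [x0 _] : exists x : X, true.
  by case: (enum X) nX => // x _ _; exists x.
pose x := nth x0 (enum X) n.
have ix : index x (enum X) = n by rewrite index_uniq ?enum_uniq.
exists x; rewrite /inbox/= -addrA -mulrDr -cumS ix un andbT.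
rewrite /cut ix leNgt; apply/negP => /nmin.
by rewrite ltnn.
Qed.

Local Lemma inpart_inj u b x y : 0 <= b.2 ->
  inbox u (inpart b x) -> inbox u (inpart b y) -> x = y.
Proof.
move=> b0; rewrite /inbox/= -!addrA -!mulrDr -!cumS.
move=> /andP[x1 x2] /andP[y1 y2].
suff H a c : b.1 + b.2 * cut a <= u -> u < b.1 + b.2 * cum (index c (enum X)).+1 ->
    (index a (enum X) <= index c (enum X))%N.
  apply: (@index_inj _ x (enum X)); rewrite ?mem_enum//.
  by apply/eqP; rewrite eqn_leq !H.
move=> au uc; rewrite leqNgt; apply/negP => /cum_le ca.
suff : u < u by rewrite ltxx.
by apply: (lt_le_trans uc); apply: le_trans au; rewrite lerD2l ler_wpM2l.
Qed.

End subdivision.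

Section law.
Variables (T : finType) (x0 : T) (p : fdist R K) (q : K -> seq T -> fdist R T).

(* Histories are stored most recent letter first. *)
Local Fixpoint box (k : K) (h : seq T) : R * R :=
  if h is x :: h' then inpart (q k (rev h')) (box k h') x
  else inpart p (0, 1) k.

Local Definition stateof (u : R) : K :=
  odflt point [pick k | inbox u (box k [::])].

Local Fixpoint hist (u : R) (n : nat) : seq T :=
  if n is m.+1 then
    let h := hist u m in
    odflt x0 [pick x | inbox u (box (stateof u) (x :: h))] :: h
  else [::].

Local Definition letter (u : R) (n : nat) : T := head x0 (hist u n.+1).

Local Lemma box_ge0 k h : 0 <= (box k h).2.
Proof. by elim: h => [|x h ih]; apply: inpart_ge0. Qed.

Local Lemma histE u n : hist u n = rev (mkseq (letter u) n).
Proof.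
elim: n => [//|n ih].
rewrite -[n.+1 in RHS]addn1 /mkseq iotaD map_cat rev_cat/= -/(mkseq _ _) -ih.
by rewrite add0n.
Qed.

Local Lemma inboxE u k h : 0 <= u < 1 ->
  inbox u (box k h) <-> stateof u = k /\ hist u (size h) = h.
Proof.
move=> u01; elim: h => [|x h ih] /=.
  have u1 : inbox u ((0, 1) : R * R) by rewrite /inbox/= add0r.
  rewrite /stateof; case: pickP => [k' uk'|nk]; split.
  - move=> uk; split=> //=; exact: (inpart_inj _ uk' uk).
  - by move=> [<- _].
  - by move=> uk; have := nk k; rewrite /= uk.
  - by have [k' uk'] := @inpart_ex _ p u (0, 1) ler01 u1; have := nk k'; rewrite /= uk'.
split=> [uxh|[uk /= [+ hh]]].
  have uh : inbox u (box k h) by apply: inpart_sub uxh; exact: box_ge0.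
  have [uk hh] := ih.1 uh; split=> //; rewrite hh uk.
  case: pickP => [y /= uy|/(_ x)/=]; last by rewrite uxh.
  by rewrite (inpart_inj (box_ge0 k h) uy uxh).
have uh : inbox u (box k h) by apply/ih.
rewrite hh uk; case: pickP => [y /= uy <-//|nx _].
by have [y uy] := inpart_ex (q k (rev h)) (box_ge0 k h) uh; have := nx y; rewrite /= uy.
Qed.

Local Lemma box_weight k h :
  (box k (rev h)).2 = p k * \prod_(t < size h) q k (take t h) (nth x0 h t).
Proof.
elim/last_ind: h => [|h x ih]; first by rewrite /= big_ord0 mul1r mulr1.
rewrite rev_rcons/= revK ih size_rcons big_ord_recr/= -mulrA.
rewrite nth_rcons ltnn eqxx -cats1 take_size_cat//; congr (_ * (_ * _)).
apply: eq_bigr => t _.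
by rewrite nth_cat ltn_ord takel_cat// ltnW.
Qed.

End law.

Local Lemma fdist_joint (s : fdist R I) (t : I -> fdist R J) :
  (forall a : I * J, 0 <= s a.1 * t a.1 a.2) /\
  \sum_(a : I * J) s a.1 * t a.1 a.2 = 1.
Proof.
split=> [a|]; first by rewrite mulr_ge0 ?fdist_ge0.
rewrite -(pair_bigA _ (fun i j => s i * t i j))/= -[RHS](fdist_sum1 s).
by apply: eq_bigr => i _; rewrite -mulr_sumr fdist_sum1 mulr1.
Qed.

Local Lemma cylinder_capE k h k' h' :
  cylinder k h `&` cylinder k' h' = set0 \/
  cylinder k h `&` cylinder k' h' = cylinder k h \/
  cylinder k h `&` cylinder k' h' = cylinder k' h'.
Proof.
have take_mk (a : nat -> I * J) m n : (m <= n)%N ->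
    mkseq a m = take m (mkseq a n).
  by move=> mn; rewrite /mkseq -map_take take_iota; have /minn_idPl -> := mn.
have [->|/set0P[w [[wk wh] [wk' wh']]]] :=
  eqVneq (cylinder k h `&` cylinder k' h') set0; first by left.
right; have [hh|hh] := leqP (size h) (size h').
- right; apply/setIidPr => v [vk vh]; split; first by rewrite vk -wk' wk.
  by rewrite (take_mk _ _ _ hh) vh -wh' -take_mk.
- left; apply/setIidPl => v [vk vh]; split; first by rewrite vk -wk wk'.
  by rewrite (take_mk _ _ _ (ltnW hh)) vh -wh -take_mk// ltnW.
Qed.

Lemma induced_by_exists p sigma tau : exists P, induced_by p sigma tau P.
Proof.
pose q k h := FDist (fdist_joint (sigma k h) (tau h)).1
                    (fdist_joint (sigma k h) (tau h)).2.
pose x0 : (I * J)%type := point.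
pose D : set R := `[0, 1[%classic.
have mD : measurable D by exact: measurable_itv.
pose X (u : R) : plays :=
  if u \in D then (stateof p q u, letter x0 p q u) else point.
have DE u : (u \in D) = (0 <= u < 1).
  by apply/idP/idP; rewrite inE /D/= in_itv.
have boxE k h : D `&` X @^-1` cylinder k h =
    `[(box p q k (rev h)).1, (box p q k (rev h)).1 + (box p q k (rev h)).2[%classic.
  apply/seteqP; split => u /=.
  - move=> [Du]; rewrite /X mem_set// => -[/= uk uh].
    rewrite in_itv/=; apply/(inboxE x0); first by rewrite -DE mem_set.
    by split=> //; rewrite size_rev histE uh.
  - rewrite in_itv/= => ub.
    have Du : 0 <= u < 1.
      have ub' : inbox u (box p q k (rev h)) by [].
      elim: (rev h) ub' => [|x h' ih] /= ub'.
        by have := inpart_sub (ler01 : 0 <= ((0, 1) : R * R).2) ub'; rewrite /inbox/= add0r.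
      by apply: ih; apply: inpart_sub ub'; exact: box_ge0.
    split; first by rewrite /D/= in_itv.
    have [uk uh] := (inboxE x0 p q k (rev h) Du).1 ub.
    rewrite /X DE Du; split=> //=.
    by apply: (can_inj revK); rewrite -histE -[in LHS](size_rev h).
have mX : measurable_fun [set: R] X.
  refine (@measurability _ _ _ _ setT X cylinders erefl _).
  move=> _ [_ [k [h ->]] <-]; rewrite setTI.
  rewrite -(setUIDK (X @^-1` cylinder k h) D) setIC boxE.
  apply: measurableU; first exact: measurable_itv.
  have [cp|ncp] := pselect (cylinder k h point).
  - rewrite (_ : _ `\` _ = ~` D); first exact: measurableC.
    apply/seteqP; split => u /=; first by case.
    by move=> nDu; split=> //; rewrite /X memNset.
  - rewrite (_ : _ `\` _ = set0)//; apply/seteqP; split => u //= [+ nDu].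
    by rewrite /X memNset.
pose mu := mrestr (@lebesgue_measure R) mD.
pose P0 := pushforward mu X.
have P01 : P0 [set: plays] = 1%E.
  rewrite /P0 /pushforward preimage_setT /mu/= /mrestr setTI.
  by rewrite lebesgue_measure_itv/= lte_fin ltr01 oppr0 adde0.
pose P : probability (plays) R :=
  HB.pack P0 (Measure_isProbability.Build _ _ _ P0 P01).
exists (P mX mX mX mX mX mX) => k h; rewrite /P/= /P0 /pushforward /mu/= /mrestr setIC boxE.
rewrite lebesgue_measure_itv/= lte_fin ltrDl.
have -> : cylinder_weight p sigma tau k h = (box p q k (rev h)).2.
  by rewrite (box_weight x0).
case: ltP => [_|b0]; first by rewrite -EFinD addrC addKr.
by congr (_%:E); apply/esym/eqP; rewrite eq_le b0 box_ge0.
Qed.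

Lemma induced_by_unique p sigma tau P Q :
  induced_by p sigma tau P -> induced_by p sigma tau Q ->
  forall A, measurable A -> P A = Q A.
Proof.
move=> iP iQ A mA.
pose G : set (set (plays)) := cylinders `|` [set set0; setT].
have CG : <<s G >> = <<s cylinders >>.
  apply/seteqP; split; apply: smallest_sub => //.
  - move=> B [cB|[->|->]].
    + exact: sub_sigma_algebra.
    + exact: (@measurable0 _ plays).
    + exact: (@measurableT _ plays).
  - by move=> B cB; apply: sub_sigma_algebra; left.
apply: (measure_unique G (fun=> setT)) => //.
- move=> B C [[k [h ->]]|[->|->]] [[k' [h' ->]]|[->|->]];
    rewrite ?set0I ?setI0 ?setTI ?setIT; try by [right; left|right; right].
  + case: (cylinder_capE k h k' h') => [->|[->|->]]; first by right; left.
      by left; exists k, h.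
    by left; exists k', h'.
  + by left; exists k, h.
  + by left; exists k', h'.
- by move=> _; right; right.
- by rewrite bigcup_const//; exists 0%N.
- move=> B [[k [h ->]]|[->|->]]; first exact: etrans (iP k h) (esym (iQ k h)).
    by rewrite !measure0.
  exact: etrans (probability_setT P) (esym (probability_setT Q)).
- by move=> _; rewrite [X in (X < _)%E](probability_setT P) ltry.
Qed.

Definition play_law p sigma tau : probability plays R :=
  sval (cid (induced_by_exists p sigma tau)).

Lemma play_lawE p sigma tau : induced_by p sigma tau (play_law p sigma tau).
Proof. exact: svalP. Qed.

Section value.
Variables (p : fdist R K) (f : play -> R).

Definition expected_payoff (sigma : strategyI) (tau : strategyII) : \bar R :=
  ('E_(play_law p sigma tau)[f])%E.

Definition maxmin : \bar R :=
  ereal_sup [set ereal_inf [set expected_payoff sigma tau | tau in setT]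
            | sigma in setT].

Definition minmax : \bar R :=
  ereal_inf [set ereal_sup [set expected_payoff sigma tau | sigma in setT]
            | tau in setT].

Definition admits_value : Prop := maxmin = minmax.

End value.

Definition shift_invariant (f : play -> R) : Prop :=
  forall (k : K) (a : nat -> I * J), f (k, a) = f (k, fun t => a t.+1).

Definition tail_measurable (f : play -> R) : Prop :=
  forall (k : K) (a b : nat -> I * J),
    finite_set [set t | (a t).1 <> (b t).1] ->
    finite_set [set t | (a t).2 <> (b t).2] ->
    f (k, a) = f (k, b).

End game.

Section example.
Variable R : realType.

(* Both {k_1, k_2} and {ell, r} are represented by bool, the second element
   k_2, resp. r, being false. *)
Definition k1 : bool := true.
Definition ell : bool := true.

Lemma fdist_half_sum1 : \sum_(k : bool) (2^-1 : R) = 1.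
Proof. by rewrite big_bool/= -[2^-1]div1r -splitr. Qed.

Lemma fdist_half_ge0 (k : bool) : 0 <= (2^-1 : R).
Proof. by rewrite invr_ge0 ler0n. Qed.

Definition prior_half : fdist R bool := FDist fdist_half_ge0 fdist_half_sum1.

Definition payoff (w : play bool bool bool) : R :=
  let: (k, a) := w in
  if `[< infinite_set [set t | (a t).2 = ell] >] then
    if k == k1 then -1 else 2
  else if `[< infinite_set [set t | (a t).1 = ell] >] then
    if k == k1 then -2 else 1
  else 0.

End example.

(* Main.v *)
Require Import Defs.
From mathcomp Require Import all_boot all_order all_algebra.
From mathcomp Require Import all_classical all_reals all_analysis.
From mathcomp Require Import lra.

(** The payoff depends only on the state and on which players play [ell]
infinitely often, which makes it shift invariant and tail measurable. There is
no value because the maxmin value is at most 1/4 and the minmax value at least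
1/2.

Write [E] for the event that Player I plays [ell] infinitely often, [L] for
the event that Player II does. Neither is decided at a finite stage, yet each
is approximated, under any given law of plays, by the event [B] that [ell]
occurs between two suitable stages [n] and [m] ([inf_often_before]). So a
player who replies to a known strategy of the opponent can play [r] up to stage
[m], and by then knows, with a small error, whether the opponent would play
[ell] infinitely often if he himself went on with [r] forever.

Player II, replying to [sigma], compares two strategies: always play [r]; or
play [r] up to stage [m], and then [ell] forever unless [B] occurred. They
cannot be told apart before stage [m]. Write [b_k] for the probability of
state [k] together with [B]. Up to multiples of the approximation error, the
first yields [- 2 b_1 + b_2] and the second at most
[- (1/2 - b_1) + 2 (1/2 - b_2) + b_2], so that the average of the two is at
most [1/4 - b_1 / 2] ([payoff_II_average]); the better of the two thus gives
at most 1/4.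

Player I, replying to [tau], always plays [r] in state [k1]. In state [k2] he
does the same up to stage [m]; he then goes on with [r] if [B] occurred, since
[L] is then nearly certain and pays 2, and otherwise plays [ell] forever,
which pays at least 1. With [q] the probability of [k1] together with [L],
state [k1] contributes [- q], and state [k2] about [2 q] on [B] and at least
[1/2 - q] off [B]: altogether 1/2 ([payoff_I_switch]).

The two events [E] and [L] play symmetric roles in these arguments, but the
information is one-sided: only Player I can make the switch depend on the state. *)

Set Implicit Arguments.
Unset Strict Implicit.
Unset Printing Implicit Defensive.

Import Order.TTheory GRing.Theory Num.Theory.
Import numFieldNormedType.Exports.

Local Open Scope classical_set_scope.
Local Open Scope ring_scope.

(** * Real-valued probabilities *)

Section real_probability.
Context d (T : measurableType d) (R : realType) (P : probability T R).
Implicit Types A B C : set T.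

Definition pr A : R := fine (P A).

Lemma prE A : measurable A -> P A = (pr A)%:E.
Proof. by move=> mA; rewrite /pr fineK// fin_num_measure. Qed.

Lemma pr_ge0 A : 0 <= pr A.
Proof. by rewrite /pr fine_ge0. Qed.

Lemma pr_cover A B C : measurable A -> measurable B -> measurable C ->
  A `<=` B `|` C -> pr A <= pr B + pr C.
Proof.
move=> mA mB mC ABC; rewrite -lee_fin EFinD -!prE//.
apply: (@le_trans _ _ (P (B `|` C))); last exact: measureU2.
by apply: le_measure => //; rewrite inE//; exact: measurableU.
Qed.

Lemma pr_sub A B : measurable A -> measurable B -> A `<=` B -> pr A <= pr B.
Proof. by move=> mA mB AB; rewrite -lee_fin -!prE// le_measure ?inE. Qed.

Lemma prID A B : measurable A -> measurable B ->
  pr A = pr (A `&` B) + pr (A `\` B).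
Proof.
move=> mA mB; apply: EFin_inj; rewrite EFinD -!prE//.
- by rewrite addeC; exact: measureDI.
- exact: measurableD.
- exact: measurableI.
Qed.

End real_probability.

(** * Infinite sets of stages *)

Lemma infinite_natP (A : set nat) :
  infinite_set A <-> forall n, exists2 t, (n <= t)%N & A t.
Proof.
split=> [inf n|unb /finite_seqP[X AX]].
- apply: contrapT => nex; apply: inf; apply: (@sub_finite_set _ _ `I_n) => // t At.
  by rewrite /= ltnNge; apply/negP => nt; apply: nex; exists t.
- have [t + At] := unb (\max_(i <- X) i).+1.
  rewrite ltnNge => /negP; apply; apply: leq_bigmax_seq => //.
  by move: At; rewrite AX.
Qed.

Lemma infinite_nat_shift (A : set nat) :
  infinite_set A <-> infinite_set [set t | A t.+1].
Proof.
split=> /infinite_natP unb; apply/infinite_natP => n.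
- by have [[//|t] nt At] := unb n.+1; exists t.
- by have [t nt At] := unb n; exists t.+1 => //; exact: leqW.
Qed.

Lemma infinite_set_almost (X : Type) (x : X) (a b : nat -> X) :
  finite_set [set t | a t <> b t] ->
  infinite_set [set t | a t = x] -> infinite_set [set t | b t = x].
Proof.
move=> ab ax bx; apply: ax; move: (conj bx ab); rewrite -finite_setU.
apply: sub_finite_set => t /= atx.
by case: (pselect (a t = b t)) => [<-|]; [left|right].
Qed.

(** * Events of the play *)

Section plays.
Variables (R : realType) (K I J : pointedFinType).
Local Notation plays := (plays K I J).
Implicit Types (P Q : probability plays R) (k : K) (h : seq (I * J)).
Implicit Types (S : pred (seq (I * J))).

Definition in_state k : set plays := [set w | w.1 = k].

(** The event that the history of the first [n] pairs of moves, from which the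
    state is left out, satisfies [S]. *)
Definition before (n : nat) (S : pred (seq (I * J))) : set plays :=
  [set w | S (mkseq w.2 n)].

Lemma measurable_cylinder k h : measurable (cylinder k h : set plays).
Proof. by apply: sub_sigma_algebra; exists k, h. Qed.

Lemma in_state_cylinder k : in_state k = cylinder k [::].
Proof. by apply/seteqP; split => w => [wk|[]]. Qed.

Lemma in_state_before k n S : in_state k `&` before n S =
  \bigcup_(h in [set h : n.-tuple (I * J) | S h]) cylinder k h.
Proof.
apply/seteqP; split=> [w [/= wk Sw]|w [h /= Sh [wk]]].
- by exists [tuple of mkseq w.2 n] => //=; split => //; rewrite size_mkseq.
- by rewrite size_tuple => wh; split=> //; rewrite /before/= wh.
Qed.

Lemma measurable_in_state k : measurable (in_state k).
Proof. by rewrite in_state_cylinder; exact: measurable_cylinder. Qed.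

Lemma measurable_before n S : measurable (before n S).
Proof.
have -> : before n S = \bigcup_k (in_state k `&` before n S).
  by apply/seteqP; split => [w Sw|w [k _ []//]]; exists w.1.
apply: fin_bigcup_measurable; first exact: finite_finset.
move=> k _; rewrite in_state_before; apply: fin_bigcup_measurable.
  exact: finite_finset.
by move=> h _; exact: measurable_cylinder.
Qed.

(** Two laws are compared here across two possibly different states: this is
    what expresses that a player who does not use his information acts alike in
    both. *)
Lemma eq_pr_before P Q k k' n S :
  (forall h, size h = n -> S h -> P (cylinder k h) = Q (cylinder k' h)) ->
  P (in_state k `&` before n S) = Q (in_state k' `&` before n S).
Proof.
move=> PQ.
have disj x : trivIset [set h : n.-tuple (I * J) | S h]
    (fun h : n.-tuple (I * J) => cylinder x h : set plays).
  move=> h h' _ _ [w [[_ wh] [_ wh']]]; apply: val_inj => /=.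
  by rewrite -wh -wh' !size_tuple.
rewrite !in_state_before !measure_fin_bigcup//; first last.
- by move=> h _; exact: measurable_cylinder.
- exact: finite_finset.
- by move=> h _; exact: measurable_cylinder.
- exact: finite_finset.
by apply: eq_fsbigr => h; rewrite inE => Sh; apply: PQ; rewrite ?size_tuple.
Qed.

Section infinitely_often.
Variable c : pred (I * J).

(** A pair of moves satisfying [c] at some [t] with [n <= t < m]. This is a test
    on the history, so that strategies can use it. *)
Definition occurs (n m : nat) h : bool := has c (drop n (take m h)).

Definition occurs_at (t : nat) : set plays := [set w | c (w.2 t)].

Definition inf_often : set plays := lim_sup_set occurs_at.

Lemma occursP (a : nat -> I * J) n m N : (m <= N)%N ->
  reflect (exists2 t, (n <= t < m)%N & c (a t)) (occurs n m (mkseq a N)).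
Proof.
move=> mN; rewrite /occurs /mkseq -map_take -map_drop take_iota drop_iota.
have /minn_idPl -> := mN.
apply: (iffP hasP) => [[x /mapP[t + ->] ct]|[t tnm ct]].
- rewrite mem_iota add0n => tnm; exists t => //.
  case/andP: tnm => nt; rewrite nt; case: (leqP n m) => [/subnKC ->//|/ltnW].
  by rewrite -subn_eq0 => /eqP->; rewrite addn0 ltnNge nt.
- exists (a t) => //; apply/mapP; exists t => //.
  rewrite mem_iota add0n; case/andP: tnm => nt tm; rewrite nt/=.
  by rewrite subnKC// (leq_trans nt (ltnW tm)).
Qed.

Lemma inf_oftenE : inf_often = [set w | infinite_set [set t | c (w.2 t)]].
Proof.
apply/seteqP; split => w /=.
- by move=> io; apply/infinite_natP => n; have [t] := io n Logic.I; exists t.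
- by move=> /infinite_natP inf n _; have [t] := inf n; exists t.
Qed.

Lemma measurable_occurs_at t : measurable (occurs_at t).
Proof.
rewrite (_ : occurs_at t = before t.+1 (occurs t t.+1)).
  exact: measurable_before.
apply/seteqP; split => w /=.
- by move=> ct; apply/occursP => //; exists t => //; rewrite leqnn ltnSn.
- by move=> /occursP; case=> // s; rewrite ltnS -eqn_leq => /eqP <-.
Qed.

Lemma measurable_inf_often : measurable inf_often.
Proof.
apply: bigcap_measurable; first by exists 0%N.
move=> n _; apply: bigcup_measurable => t _; exact: measurable_occurs_at.
Qed.

Lemma inf_oftenPn w : ~ inf_often w -> exists n, forall t, (n <= t)%N -> ~~ c (w.2 t).
Proof.
move=> nio; apply: contrapT => /forallNP nex; apply: nio => n _.
by apply: contrapT => nc; apply: (nex n) => t nt; apply/negP => ct; apply: nc; exists t.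
Qed.

Lemma occurs_take n m t h : (m <= t)%N ->
  occurs n m (take t h) = occurs n m (take m h).
Proof. by move=> mt; rewrite /occurs take_takel // take_taker. Qed.

Lemma occurs_mkseq (a : nat -> I * J) n m t : (m <= t)%N ->
  occurs n m (mkseq a t) = occurs n m (mkseq a m).
Proof. by move=> mt; apply/occursP/occursP. Qed.

Definition occurs_after (n : nat) : set plays :=
  \bigcup_(t in [set t | (n <= t)%N]) occurs_at t.

Lemma measurable_occurs_after n : measurable (occurs_after n).
Proof. by apply: bigcup_measurable => t _; exact: measurable_occurs_at. Qed.

(** Continuity from below. The event [C] is carried along so that the
    comparison of two laws on a part of the space can pass to the limit. *)
Lemma cvg_pr_occurs P (C : set plays) n : measurable C ->
  pr P (C `&` before m (occurs n m)) @[m --> \oo] --> pr P (C `&` occurs_after n).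
Proof.
move=> mC; have mF m : measurable (C `&` before m (occurs n m)).
  by apply: measurableI => //; exact: measurable_before.
have FU : \bigcup_m (C `&` before m (occurs n m)) = C `&` occurs_after n.
  rewrite -setI_bigcupr; congr (_ `&` _); apply/seteqP; split => w.
  - by move=> [m _ /occursP[]// t /andP[nt _] ct]; exists t.
  - move=> [t nt ct]; exists t.+1 => //; apply/occursP => //.
    by exists t => //; rewrite ltnSn andbT.
have mU := measurable_occurs_after n.
apply: fine_cvg; rewrite -prE; last exact: measurableI.
rewrite -FU; apply: nondecreasing_cvg_mu => //.
  by rewrite FU; exact: measurableI.
move=> m m' mm'; apply/subsetPset; apply: setIS => w /occursP[]// t /andP[nt tm] ct.
by apply/occursP => //; exists t => //; rewrite nt (leq_trans tm mm').
Qed.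

(** Continuity from above, [C `&` inf_often] being the limit superior of the
    events [C `&` occurs_at t]. *)
Lemma cvg_pr_occurs_after P (C : set plays) : measurable C ->
  pr P (C `&` occurs_after n) @[n --> \oo] --> pr P (C `&` inf_often).
Proof.
move=> mC; pose F t := C `&` occurs_at t.
have mF t : measurable (F t).
  by apply: measurableI => //; exact: measurable_occurs_at.
have FU n : \bigcup_(t in [set t | (n <= t)%N]) F t = C `&` occurs_after n.
  by rewrite -setI_bigcupr.
have FL : lim_sup_set F = C `&` inf_often.
  apply/seteqP; split=> [w Fw|w [Cw iw] n _].
  - split; first by have [t _ []] := Fw 0%N Logic.I.
    by move=> n _; have [t nt []] := Fw n Logic.I; exists t.
  - by have [t nt] := iw n Logic.I; exists t.
apply: fine_cvg; rewrite -prE; last first.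
  by apply: measurableI => //; exact: measurable_inf_often.
rewrite -FL (_ : (fun n => P _) = (fun n => P (\bigcup_(t >= n) F t))).
  apply: lim_sup_set_cvg => //; rewrite -ge0_fin_numE//.
  rewrite fin_num_measure// FU; apply: measurableI => //.
  exact: measurable_occurs_after.
by apply/funext => n; rewrite FU.
Qed.

(** This takes the place of Levy's zero-one law, without martingales: choose [n]
    for which an occurrence after [n] is hardly more likely than infinitely many,
    then [m] for which an occurrence after [n] nearly always comes before [m]. *)
Lemma inf_often_before P e : 0 < e -> exists n m,
  pr P (inf_often `\` before m (occurs n m)) <= e /\
  pr P (before m (occurs n m) `\` inf_often) <= e.
Proof.
move=> e0; have mL := measurable_inf_often.
have := cvg_pr_occurs_after (P := P) measurableT; rewrite setTI => cvgL.
have [n Un] : exists n, pr P (occurs_after n) <= pr P inf_often + e.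
  have /(cvgr_lt _ cvgL)[N _ HN] : pr P inf_often < pr P inf_often + e.
    by rewrite ltrDl.
  by exists N; have := HN N (leqnn N); rewrite /= setTI => /ltW.
have := cvg_pr_occurs (P := P) (n := n) measurableT; rewrite setTI => cvgU.
have [m Vm] : exists m,
    pr P (occurs_after n) - e <= pr P (before m (occurs n m)).
  have /(cvgr_gt _ cvgU)[N _ HN] : pr P (occurs_after n) - e < pr P (occurs_after n).
    by rewrite gtrBl.
  by exists N; have := HN N (leqnn N); rewrite /= setTI => /ltW.
exists n, m; set B := before m _ in Vm *.
have mB : measurable B by exact: measurable_before.
have mU := measurable_occurs_after n.
have LU : inf_often `<=` occurs_after n by exact: bigcap_inf.
have BU : B `<=` occurs_after n.
  by move=> w /occursP[]// t /andP[nt _] ct; exists t.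
split.
- have := prID P mU mB; rewrite (setIidr BU).
  have := pr_sub P (measurableD mL mB) (measurableD mU mB) (setSD LU).
  lra.
- have := prID P mU mL; rewrite (setIidr LU).
  have := pr_sub P (measurableD mB mL) (measurableD mU mL) (setSD BU).
  lra.
Qed.

(** Laws that agree on the cylinders inside [before m S] agree there on
    [inf_often]: this event is a double limit of events of finite horizon, for
    each of which [eq_pr_before] applies. *)
Lemma eq_pr_inf_often P Q k k' m S :
  (forall h, (m <= size h)%N -> S (take m h) ->
    P (cylinder k h) = Q (cylinder k' h)) ->
  pr P (in_state k `&` before m S `&` inf_often) =
  pr Q (in_state k' `&` before m S `&` inf_often).
Proof.
move=> PQ; have mC x : measurable (in_state x `&` before m S).
  by apply: measurableI; [exact: measurable_in_state|exact: measurable_before].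
have take_before (w : plays) N : (m <= N)%N ->
    take m (mkseq w.2 N) = mkseq w.2 m.
  by move=> mN; rewrite /mkseq -map_take take_iota; have /minn_idPl -> := mN.
suff PQn n : pr P (in_state k `&` before m S `&` occurs_after n) =
             pr Q (in_state k' `&` before m S `&` occurs_after n).
  have := cvg_pr_occurs_after (P := Q) (mC k').
  rewrite (_ : (fun n => pr Q _) = (fun n =>
      pr P (in_state k `&` before m S `&` occurs_after n))); last first.
    by apply/funext => n; rewrite PQn.
  exact: cvg_unique (cvg_pr_occurs_after (P := P) (mC k)).
apply: (cvg_unique (@norm_hausdorff _ _) (cvg_pr_occurs (P := P) (n := n) (mC k))).
apply: cvg_trans (cvg_pr_occurs (P := Q) (n := n) (mC k')).
apply: near_eq_cvg; exists m => // N /= mN.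
have E x : in_state x `&` before m S `&` before N (occurs n N) =
    in_state x `&` before N (fun h => S (take m h) && occurs n N h).
  rewrite -setIA; congr (_ `&` _); apply/seteqP.
  by split=> w; rewrite /before/= take_before// => /andP.
rewrite !E /pr; congr fine; apply/esym/eq_pr_before => h hN /andP[Sh _].
by apply: PQ => //; rewrite hN.
Qed.

End infinitely_often.

(** * Laws induced by strategies *)

Section law_of_strategies.
Variables (p : fdist R K).
Implicit Types (sigma : strategyI R K I J) (tau : strategyII R I J).

Lemma play_law_cylinder sigma tau k h :
  play_law p sigma tau (cylinder k h) = (cylinder_weight p sigma tau k h)%:E.
Proof. exact: play_lawE. Qed.

Lemma eq_play_law sigma tau sigma' tau' k k' h : p k = p k' ->
  (forall t, (t < size h)%N -> sigma k (take t h) = sigma' k' (take t h)) ->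
  (forall t i, (t < size h)%N -> tau (take t h) i = tau' (take t h) i) ->
  play_law p sigma tau (cylinder k h) = play_law p sigma' tau' (cylinder k' h).
Proof.
move=> pk ss tt; rewrite !play_law_cylinder /cylinder_weight pk; congr (_ * _)%:E.
by apply: eq_bigr => t _; rewrite ss// tt.
Qed.

(** Each play in [A] has a prefix of probability zero, and there are only
    countably many cylinders. *)
Lemma pr_impossible sigma tau (A : set plays) : measurable A ->
  (forall w, A w -> exists t, sigma w.1 (mkseq w.2 t) (w.2 t).1 = 0 \/
    tau (mkseq w.2 t) (w.2 t).1 (w.2 t).2 = 0) ->
  pr (play_law p sigma tau) A = 0.
Proof.
move=> mA Aw; set P := play_law p sigma tau.
pose F i : set plays :=
  if unpickle i is Some x then
    if cylinder_weight p sigma tau x.1 x.2 == 0 then cylinder x.1 x.2 else set0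
  else set0.
suff : P.-negligible A by move=> /(negligibleP _ mA); rewrite /pr => ->.
apply: (@negligibleS _ _ _ _ (\bigcup_i F i)).
- move=> w /Aw[t w0].
  exists (pickle (w.1, mkseq w.2 t.+1)) => //; rewrite /F pickleK/=.
  rewrite ifT; first by split=> //; rewrite size_mkseq.
  rewrite /cylinder_weight size_mkseq big_ord_recr/= nth_mkseq//.
  rewrite /mkseq -map_take take_iota (minn_idPl (leqnSn t)) -/(mkseq _ _).
  by case: w0 => ->; rewrite ?mul0r ?mulr0.
- apply: negligible_bigcup => i; rewrite /F.
  case: unpickle => [[k h]/=|]; last exact: negligible_set0.
  case: eqP => [w0|_]; last exact: negligible_set0.
  apply/negligibleP; first exact: measurable_cylinder.
  by apply: etrans (play_law_cylinder sigma tau k h) _; rewrite w0.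
Qed.

Lemma pr_in_state sigma tau k : pr (play_law p sigma tau) (in_state k) = p k.
Proof.
rewrite in_state_cylinder /pr play_law_cylinder /cylinder_weight/=.
by rewrite big_ord0 mulr1.
Qed.

End law_of_strategies.

End plays.

(** * The game without a value *)

Section example.
Variable R : realType.
Local Notation plays := (plays bool bool bool).
Local Notation k2 := false.
Local Notation law := (@play_law R bool bool bool (prior_half R)).
Implicit Types (P : probability plays R).
Implicit Types (sigma : strategyI R bool bool bool) (tau : strategyII R bool bool).

Lemma pure_ge0 (b x : bool) : 0 <= (x == b)%:R :> R.
Proof. exact: ler0n. Qed.

Lemma pure_sum1 (b : bool) : \sum_(x : bool) (x == b)%:R = 1 :> R.
Proof. by rewrite big_bool; case: b => /=; rewrite ?addr0 ?add0r. Qed.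

Definition pure (b : bool) : fdist R bool := FDist (pure_ge0 b) (pure_sum1 b).

Definition I_ell : pred (bool * bool) := fun a => a.1.
Definition J_ell : pred (bool * bool) := fun a => a.2.

Local Notation E := (inf_often I_ell : set plays).
Local Notation L := (inf_often J_ell : set plays).

(** Only four of the six cases of the payoff are nonzero; this is its mean as a
    combination of the probabilities of these four events. *)
Definition payoff_mean P : R :=
  - pr P (in_state k1 `&` L) + 2 * pr P (in_state k2 `&` L)
  - 2 * pr P (in_state k1 `&` (E `\` L)) + pr P (in_state k2 `&` (E `\` L)).

Let mE : measurable E := measurable_inf_often I_ell.
Let mL : measurable L := measurable_inf_often J_ell.
Let mS k : measurable (in_state k : set plays) := measurable_in_state k.
Let mEL : measurable (E `\` L) := measurableD mE mL.

Lemma expectation_payoff P : ('E_P[payoff R] = (payoff_mean P)%:E)%E.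
Proof.
pose ind (A : set plays) : plays -> R := \1_A.
have iA (A : set plays) (c : R) : measurable A -> c \o* ind A \in Lfun P 1.
  by move=> mA; apply: Lfun_scale => //; apply/Lfun1_integrable/integrable_indic.
have EA (A : set plays) (c : R) : measurable A ->
    ('E_P[c \o* ind A] = (c * pr P A)%:E)%E.
  move=> mA; rewrite expectationZl; first by rewrite expectation_indic// prE.
  exact/Lfun1_integrable/integrable_indic.
have mSL k : measurable (in_state k `&` L) by exact: measurableI.
have mSEL k : measurable (in_state k `&` (E `\` L)) by exact: measurableI.
have -> : payoff R = (-1 \o* ind (in_state k1 `&` L))
    \+ ((2 \o* ind (in_state k2 `&` L))
    \+ ((-2 \o* ind (in_state k1 `&` (E `\` L)))
    \+ (1 \o* ind (in_state k2 `&` (E `\` L))))).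
  apply/funext => -[k a]; rewrite /payoff /ind/=.
  rewrite !indicE !(in_setI, in_setD).
  have inS x : ((k, a) \in (in_state x : set plays)) = (k == x).
    by apply/idP/eqP; rewrite inE.
  have inA (c : pred (bool * bool)) (A : set nat) : A = [set t | c (a t)] ->
      ((k, a) \in (inf_often c : set plays)) = `[< infinite_set A >].
    move=> ->; rewrite inf_oftenE; apply/idP/asboolP; rewrite inE//.
  rewrite !inS -(inA J_ell)// -(inA I_ell)//.
  by case: k {inS inA} => /=; case: (_ \in L); case: (_ \in E) => /=; lra.
rewrite expectationD ?EA//; first last.
- by rewrite rpredD ?iA// rpredD ?iA.
- exact: iA.
rewrite expectationD ?EA//; first last.
- by rewrite rpredD ?iA.
- exact: iA.
rewrite expectationD ?EA ?iA// -!EFinD; congr EFin; rewrite /payoff_mean; lra.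
Qed.

Local Ltac measurability := repeat first
  [ exact: measurable_inf_often | exact: measurable_in_state
  | exact: measurable_before
  | apply: measurableI | apply: measurableD | apply: measurableC ].

Lemma expected_payoffE sigma tau :
  expected_payoff (prior_half R) (payoff R) sigma tau =
  (payoff_mean (law sigma tau))%:E.
Proof. exact: expectation_payoff. Qed.

Lemma pr_state_before sigma tau k m S :
  2^-1 = pr (law sigma tau) (in_state k `&` before m S)
         + pr (law sigma tau) (in_state k `\` before m S).
Proof.
rewrite -prID; first exact/esym/pr_in_state.
- exact: measurable_in_state.
- exact: measurable_before.
Qed.

Definition II_always_r : strategyII R bool bool := fun _ _ => pure false.

(** Plays [ell] from stage [m] on, provided that Player I did not play [ell]
    between [n] and [m]. *)
Definition II_switch (n m : nat) : strategyII R bool bool := fun past _ =>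
  pure ((m <= size past)%N && ~~ occurs I_ell n m past).

Definition I_always_r : strategyI R bool bool bool := fun _ _ => pure false.

(** Plays [ell] from stage [m] on, provided that the state is [k2] and that
    Player II did not play [ell] between [n] and [m]. *)
Definition I_switch (n m : nat) : strategyI R bool bool bool := fun k past =>
  pure [&& k == k2, (m <= size past)%N & ~~ occurs J_ell n m past].

(** Replies of Player II to [sigma]. Let [b_k] be the probability of state [k]
    with [B]; both replies give it the same value. Under the first one, [L] is
    null and [E] is close to [B], so the payoff is about [- 2 b_1 + b_2]. Under the
    second one, [L] coincides with the complement of [B] up to a null event, so
    the payoff is at most [- (1/2 - b_1) + 2 (1/2 - b_2) + b_2], where the
    losses of Player I in state [k1] on [B] are dropped. The sum is
    [1/2 - b_1]. *)
Lemma payoff_II_average sigma e : 0 < e -> exists n m,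
  payoff_mean (law sigma II_always_r) +
  payoff_mean (law sigma (II_switch n m)) <= 2^-1 + 3 * e.
Proof.
move=> e0; set P0 := law sigma II_always_r.
have [n [m [EB BE]]] := inf_often_before I_ell P0 e0; exists n, m.
set P1 := law sigma (II_switch n m).
set B := before m _ in EB BE.
have B01 k : pr P1 (in_state k `&` B) = pr P0 (in_state k `&` B).
  congr fine; apply: eq_pr_before => h hm _; apply: eq_play_law => // t i th.
  by rewrite /II_switch (size_takel (ltnW th)) -hm leqNgt th.
have L0 : pr P0 L = 0.
  apply: pr_impossible => [|w Lw]; first by measurability.
  have [t _ jt] := Lw 0%N Logic.I.
  by exists t; right; rewrite /II_always_r/= (jt : is_true (w.2 t).2).
have LB0 : pr P1 (L `&` B) = 0.
  apply: pr_impossible => [|w [Lw Bw]]; first by measurability.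
  have [t _ jt] := Lw 0%N Logic.I.
  exists t; right; rewrite /II_switch/= size_mkseq (jt : is_true (w.2 t).2).
  by case: leqP => //= mt; rewrite occurs_mkseq// (Bw : is_true _).
have BL0 : pr P1 (~` B `\` L) = 0.
  apply: pr_impossible => [|w [Bw Lw]]; first by measurability.
  have [N NL] := inf_oftenPn Lw.
  exists (maxn N m); right; rewrite /II_switch/= size_mkseq leq_maxr/=.
  rewrite occurs_mkseq ?leq_maxr// (negbTE (NL _ (leq_maxl N m) : ~~ (w.2 _).2)).
  by rewrite (introN idP Bw).
have S1 := pr_state_before sigma (II_switch n m) k1 m (occurs I_ell n m).
have S2 := pr_state_before sigma (II_switch n m) k2 m (occurs I_ell n m).
rewrite -/P1 -/B !B01 in S1 S2.
(* Bounds on the payoff against II_always_r, then against II_switch. *)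
have c1 : pr P0 (in_state k1 `&` B) <= pr P0 (in_state k1 `&` E) + pr P0 (B `\` E).
  apply: pr_cover; [by measurability..|] => w [Sw Bw].
  by case: (pselect (E w)); [left|right].
have c2 : pr P0 (in_state k1 `&` E) <= pr P0 (in_state k1 `&` (E `\` L)) + pr P0 L.
  apply: pr_cover; [by measurability..|] => w [Sw Ew].
  by case: (pselect (L w)); [right|left].
have c3 : pr P0 (in_state k2 `&` (E `\` L)) <=
    pr P0 (in_state k2 `&` B) + pr P0 (E `\` B).
  apply: pr_cover; [by measurability..|] => w [Sw [Ew _]].
  by case: (pselect (B w)); [left|right].
have c4 : pr P0 (in_state k2 `&` L) <= pr P0 L.
  by apply: pr_sub; [by measurability..|] => w [].
have d1 : pr P1 (in_state k1 `\` B) <= pr P1 (in_state k1 `&` L) + pr P1 (~` B `\` L).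
  apply: pr_cover; [by measurability..|] => w [Sw Bw].
  by case: (pselect (L w)); [left|right].
have d2 : pr P1 (in_state k2 `&` L) <= pr P1 (in_state k2 `\` B) + pr P1 (L `&` B).
  apply: pr_cover; [by measurability..|] => w [Sw Lw].
  by case: (pselect (B w)); [right|left].
have d3 : pr P1 (in_state k2 `&` (E `\` L)) <=
    pr P1 (in_state k2 `&` B) + pr P1 (~` B `\` L).
  apply: pr_cover; [by measurability..|] => w [Sw [_ Lw]].
  by case: (pselect (B w)); [left|right].
rewrite B01 in d3.
have := pr_ge0 P0 (in_state k1 `&` L).
have := pr_ge0 P1 (in_state k1 `&` (E `\` L)).
have := pr_ge0 P0 (in_state k1 `&` B).
rewrite /payoff_mean; lra.
Qed.

(** Reply of Player I to [tau]. In state [k1], and in state [k2] before stage [m]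
    and later on [B], it coincides with always playing [r]; so [L] has in state [k1], and
    [B `&` L] has in state [k2], the probability computed under [I_always_r]
    in state [k1]. Let [q] be the first of these, which is close to the
    probability of [k1] with [B]. State [k1] pays [- q]; state [k2] pays 2 on
    [B `&` L], a probability of about [q], and at least 1 off [B], an event of
    probability about [1/2 - q], since there [E] is almost sure. *)
Lemma payoff_I_switch tau e : 0 < e -> exists n m,
  2^-1 - 3 * e <= payoff_mean (law (I_switch n m) tau).
Proof.
move=> e0; set P0 := law I_always_r tau.
have [n [m [LB BL]]] := inf_often_before J_ell P0 e0; exists n, m.
set P1 := law (I_switch n m) tau.
set B := before m _ in LB BL.
have switchE (k : bool) (h : seq (bool * bool)) t :
    (t < size h)%N -> (k == k1) || occurs J_ell n m (take m h) ->
    I_switch n m k (take t h) = I_always_r k1 (take t h).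
  move=> th kh; rewrite /I_switch /I_always_r (size_takel (ltnW th)).
  case: leqP => [mt|_]; last by rewrite andbF.
  by rewrite occurs_take//; case: k kh => //= ->.
(* In state k1 the two strategies coincide from the start, so the condition
   on the history is void. *)
have L01 : pr P1 (in_state k1 `&` L) = pr P0 (in_state k1 `&` L).
  have := @eq_pr_inf_often R bool bool bool J_ell P1 P0 k1 k1 0 xpredT.
  rewrite (_ : before 0 xpredT = setT) ?setIT; last by apply/seteqP; split.
  by apply=> h _ _; apply: eq_play_law.
have B01 : pr P1 (in_state k2 `&` B) = pr P0 (in_state k1 `&` B).
  congr fine; apply: eq_pr_before => h hm Bh; apply: eq_play_law => // t th.
  by apply: switchE => //; rewrite -hm take_size hm Bh orbT.
have LB01 : pr P1 (in_state k2 `&` B `&` L) = pr P0 (in_state k1 `&` B `&` L).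
  apply: eq_pr_inf_often => h mh Bh; apply: eq_play_law => // t th.
  by apply: switchE => //; rewrite Bh orbT.
have E0 : pr P1 (in_state k1 `&` E) = 0.
  apply: pr_impossible => [|w [Sw Ew]]; first by measurability.
  have [t _ it] := Ew 0%N Logic.I.
  by exists t; left; rewrite /I_switch (Sw : w.1 = k1)/= (it : is_true (w.2 t).1).
have BE0 : pr P1 ((in_state k2 `\` B) `\` E) = 0.
  apply: pr_impossible => [|w [[Sw Bw] Ew]]; first by measurability.
  have [N NE] := inf_oftenPn Ew.
  exists (maxn N m); left; rewrite /I_switch/= size_mkseq leq_maxr/=.
  rewrite occurs_mkseq ?leq_maxr// (negbTE (NE _ (leq_maxl N m) : ~~ (w.2 _).1)).
  by rewrite (Sw : w.1 = k2) (introN idP Bw).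
have S2 := pr_state_before (I_switch n m) tau k2 m (occurs J_ell n m).
rewrite -/P1 -/B B01 in S2.
have c1 : pr P0 (in_state k1 `&` L) <= pr P0 (in_state k1 `&` B `&` L) + pr P0 (L `\` B).
  apply: pr_cover; [by measurability..|] => w [Sw Lw].
  by case: (pselect (B w)); [left|right].
have c2 : pr P0 (in_state k1 `&` B) <= pr P0 (in_state k1 `&` L) + pr P0 (B `\` L).
  apply: pr_cover; [by measurability..|] => w [Sw Bw].
  by case: (pselect (L w)); [left|right].
have d1 : pr P1 (in_state k1 `&` (E `\` L)) <= pr P1 (in_state k1 `&` E).
  by apply: pr_sub; [by measurability..|] => w [Sw []].
have d2 : pr P1 (in_state k2 `&` L) =
    pr P1 (in_state k2 `&` B `&` L) + pr P1 ((in_state k2 `\` B) `&` L).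
  rewrite (prID _ (B := B)); [|by measurability..].
  by congr (pr P1 _ + pr P1 _); rewrite ?setDE setIAC.
have d3 : pr P1 (in_state k2 `\` B) <= pr P1 ((in_state k2 `\` B) `&` E) +
    pr P1 ((in_state k2 `\` B) `\` E).
  by rewrite -prID//; measurability.
have d4 : pr P1 ((in_state k2 `\` B) `&` E) <=
    pr P1 ((in_state k2 `\` B) `&` L) + pr P1 (in_state k2 `&` (E `\` L)).
  apply: pr_cover; [by measurability..|] => w [[Sw Bw] Ew].
  by case: (pselect (L w)); [left|right].
have := pr_ge0 P1 ((in_state k2 `\` B) `&` L).
rewrite /payoff_mean; lra.
Qed.

Lemma maxmin_le : (maxmin (prior_half R) (payoff R) <= (4^-1)%:E)%E.
Proof.
apply: ge_ereal_sup => _ [sigma _ <-].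
apply/lee_addgt0Pr => e e0; rewrite -EFinD.
have [n [m avg]] := payoff_II_average sigma (divr_gt0 e0 (ltr0n R 3)).
have inf_le tau : payoff_mean (law sigma tau) <= 4^-1 + e ->
    (ereal_inf [set expected_payoff (prior_half R) (payoff R) sigma tau | tau in setT]
     <= (4^-1 + e)%:E)%E.
  move=> h; apply: (@le_trans _ _ (payoff_mean (law sigma tau))%:E).
    by apply: ereal_inf_lbound; exists tau => //; rewrite expected_payoffE.
  by rewrite lee_fin.
case: (lerP (payoff_mean (law sigma II_always_r)) (4^-1 + e)) => [/inf_le//|h].
by apply: (inf_le (II_switch n m)); lra.
Qed.

Lemma minmax_ge : ((2^-1)%:E <= minmax (prior_half R) (payoff R))%E.
Proof.
apply: le_ereal_inf_tmp => _ [tau _ <-].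
apply/lee_subgt0Pr => e e0; rewrite -EFinB.
have [n [m switch]] := payoff_I_switch tau (divr_gt0 e0 (ltr0n R 3)).
apply: (@le_trans _ _ (payoff_mean (law (I_switch n m) tau))%:E).
  by rewrite lee_fin; lra.
by apply: ereal_sup_ubound; exists (I_switch n m) => //; rewrite expected_payoffE.
Qed.

Lemma eq_payoff (k : bool) (a b : nat -> bool * bool) :
  (infinite_set [set t | (a t).1 = ell] <-> infinite_set [set t | (b t).1 = ell]) ->
  (infinite_set [set t | (a t).2 = ell] <-> infinite_set [set t | (b t).2 = ell]) ->
  payoff R (k, a) = payoff R (k, b).
Proof. by move=> /propext ab1 /propext ab2; rewrite /payoff ab1 ab2. Qed.

Lemma shift_invariant_payoff : shift_invariant (payoff R).
Proof. by move=> k a; apply: eq_payoff; exact: infinite_nat_shift. Qed.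

Lemma tail_measurable_payoff : tail_measurable (payoff R).
Proof.
have sym (f g : nat -> bool) :
    finite_set [set t | f t <> g t] -> finite_set [set t | g t <> f t].
  by apply: sub_finite_set => t /= gf /esym.
move=> k a b ab1 ab2.
by apply: eq_payoff; split; apply: infinite_set_almost => //; exact: sym.
Qed.

End example.

Theorem mainTheorem2 (R : realType) :
  shift_invariant (payoff R) /\
  tail_measurable (payoff R) /\
  ~ admits_value (prior_half R) (payoff R).
Proof.
split; first exact: shift_invariant_payoff.
split; first exact: tail_measurable_payoff.
move=> value; have := le_trans (minmax_ge R).
rewrite -[minmax _ _]value => /(_ _ (maxmin_le R)).
by rewrite lee_fin; lra.
Qed.
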